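(* Let $t\ge 3$ be an integer and let $G$ be a $C_t$-free graph of order $n$. (i) If $t$ is odd or $n<t$, then $\lambda_n(G)\geq -\sqrt{\lfloor\frac n2\rfloor\lceil\frac n2\rceil}$, and equality holds if and only if $G\cong K_{\lfloor\frac n2\rfloor, \lceil\frac n2\rceil}$. (ii) If $t=2k+2$ for an integer $k\ge 1$ and $n\geq t$, then $\lambda_n(G)\geq -\sqrt{k(n-k)}$, and equality holds if and only if $G\cong K_{k,n-k}$.
   Context: All graphs are finite and simple. $\lambda_n(G)$ denotes the least eigenvalue of the adjacency matrix of a graph $G$ of order $n$. $C_t$ denotes the cycle on $t$ vertices. A graph is $H$-free if it contains no subgraph isomorphic to $H$. $K_{a,b}$ is the complete bipartite graph with parts of sizes $a$ and $b$. *)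

(* Defs.v *)
From HB Require Import structures.
From mathcomp Require Import all_boot all_order all_algebra.
From mathcomp Require Import classical_sets reals.
From mathcomp Require Import complex polyrcf.
Set Implicit Arguments.
Unset Strict Implicit.
Unset Printing Implicit Defensive.
Import Order.TTheory GRing.Theory Num.Theory.

Record sgraph := SGraph {
  vertex :> finType;
  edge : rel vertex;
  edge_sym : symmetric edge;
  edge_irr : irreflexive edge }.

Definition isomorphic (G H : sgraph) : Prop :=
  exists2 f : G -> H, bijective f & forall x y, edge (f x) (f y) = edge x y.

(* [f] identifies [H] with a (not necessarily induced) subgraph of [G]. *)
Definition contains_copy (H G : sgraph) : Prop :=
  exists2 f : H -> G,
    injective f & forall x y, edge x y -> edge (f x) (f y).

Definition free_of (H G : sgraph) : Prop := ~ contains_copy H G.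

(* The conjunct [i != j] only matters for [t = 1], where it rules out a loop;
   this is the usual cycle when [3 <= t]. *)
Definition cycle_edge (t : nat) : rel 'I_t :=
  [rel i j : 'I_t | (i != j) && ((j == i.+1 %% t :> nat) || (i == j.+1 %% t :> nat))].

Lemma cycle_edge_sym t : symmetric (@cycle_edge t).
Proof. by move=> i j; rewrite /cycle_edge /= eq_sym orbC. Qed.

Lemma cycle_edge_irr t : irreflexive (@cycle_edge t).
Proof. by move=> i; rewrite /cycle_edge /= eqxx. Qed.

Definition cycle_graph (t : nat) : sgraph :=
  SGraph (@cycle_edge_sym t) (@cycle_edge_irr t).

Definition biclique_edge (a b : nat) : rel ('I_a + 'I_b) :=
  fun x y => match x, y with
             | inl _, inr _ | inr _, inl _ => true
             | _, _ => false
             end.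

Lemma biclique_edge_sym a b : symmetric (@biclique_edge a b).
Proof. by case=> ? [?|?]. Qed.

Lemma biclique_edge_irr a b : irreflexive (@biclique_edge a b).
Proof. by case. Qed.

Definition complete_bipartite (a b : nat) : sgraph :=
  SGraph (@biclique_edge_sym a b) (@biclique_edge_irr a b).

Local Open Scope ring_scope.
Local Open Scope classical_set_scope.

Definition adjacency_mx (R : realType) (G : sgraph) : 'M[R]_#|G| :=
  \matrix_(i, j) (edge (enum_val i) (enum_val j))%:R.

(* The infimum is attained as soon as [G] has a vertex: see
   [lambda_min_eigenvalue] and [lambda_min_le]. *)
Definition lambda_min (R : realType) (G : sgraph) : R :=
  inf [set a : R | eigenvalue (adjacency_mx R G) a].

Lemma adjacency_mx_sym (R : realType) (G : sgraph) :
  (adjacency_mx R G)^T = adjacency_mx R G.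
Proof. by apply/matrixP=> i j; rewrite !mxE edge_sym. Qed.

Lemma symmetric_eigenvalue_exists (R : realType) n (A : 'M[R]_n) :
  (0 < n)%N -> A^T = A -> exists a : R, eigenvalue A a.
Proof.
move=> n_gt0 symA.
pose B : 'M[R[i]]_n := map_mx (real_complex R) A.
have [z rz] : exists z, root (char_poly B) z.
  by apply/closed_rootP; rewrite size_char_poly; case: (n) n_gt0.
have := rz; rewrite -eigenvalue_root_char => /eigenvalueP[v vB v0].
pose w := (map_mx Num.conj v)^T.
have Bw : B *m w = z^* *: w.
  have BT : B^T = B by rewrite /B -[in RHS]symA map_trmx.
  have Bc : map_mx Num.conj B = B.
    apply/matrixP=> i j; rewrite !mxE; apply/CrealP.
    by rewrite complex_real.
  rewrite /w -[B in LHS]BT -trmx_mul -[B in LHS]Bc -map_mxM vB map_mxZ.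
  by rewrite linearZ.
have nz : (v *m w) 0 0 != 0.
  rewrite !mxE; under eq_bigr do rewrite !mxE -normCK.
  rewrite psumr_eq0; last by move=> i _; rewrite exprn_ge0.
  apply: contra v0 => /allP h; apply/eqP/rowP=> i; rewrite mxE.
  have := h i; rewrite mem_index_enum => /(_ isT).
  by rewrite expf_eq0 /= normr_eq0 => /eqP.
have zr : z \is Num.real.
  apply/CrealP; apply: (mulIf nz).
  have := congr1 (fun M : 'M_1 => M 0 0) (mulmxA v B w).
  by rewrite Bw vB -scalemxAr -scalemxAl !mxE.
have [x zx] : exists x : R, z = x%:C%C by apply/complex_realP.
exists x; rewrite eigenvalue_root_char.
by rewrite -(fmorph_root (real_complex R)) map_char_poly; move: rz; rewrite zx.
Qed.

Lemma symmetric_least_eigenvalue (R : realType) n (A : 'M[R]_n) :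
  (0 < n)%N -> A^T = A ->
  exists2 a : R, eigenvalue A a & forall b, eigenvalue A b -> a <= b.
Proof.
move=> n_gt0 /(symmetric_eigenvalue_exists n_gt0)[x].
have p0 : char_poly A != 0 by rewrite monic_neq0 ?char_poly_monic.
have E y : eigenvalue A y = (y \in rootsR (char_poly A)).
  by rewrite eigenvalue_root_char -(roots_on_rootsR p0).
have : sorted <=%R (rootsR (char_poly A)).
  by apply: sub_sorted (sorted_roots _ _ _) => ? ? /ltW.
rewrite E; move Es: (rootsR _) E => [//|a s] E srt _.
exists a => [|b]; first by rewrite E mem_head.
rewrite E inE => /predU1P[-> //|].
by apply/allP/order_path_min => //; apply: le_trans.
Qed.

Lemma lambda_minP (R : realType) (G : sgraph) : (0 < #|G|)%N ->
  eigenvalue (adjacency_mx R G) (lambda_min R G) /\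
  forall b, eigenvalue (adjacency_mx R G) b -> lambda_min R G <= b.
Proof.
move=> /symmetric_least_eigenvalue /(_ (adjacency_mx_sym R G))[a ea mina].
suff -> : lambda_min R G = a by [].
apply/le_anti/andP; split.
  by apply: ge_inf => //; exists a.
by apply: lb_le_inf => //; exists a.
Qed.

Lemma lambda_min_eigenvalue (R : realType) (G : sgraph) : (0 < #|G|)%N ->
  eigenvalue (adjacency_mx R G) (lambda_min R G).
Proof. by case/(lambda_minP R). Qed.

Lemma lambda_min_le (R : realType) (G : sgraph) (b : R) : (0 < #|G|)%N ->
  eigenvalue (adjacency_mx R G) b -> lambda_min R G <= b.
Proof. by case/(lambda_minP R) => _; apply. Qed.

(* Main.v *)
(** Let [x] be an eigenfunction for the least eigenvalue [-r], normalised so that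
    [x v > 0] is the largest entry in absolute value; let [X] and [Y] be the sets
    where [x] is positive and negative, and [A] the set of neighbours of [v] in
    [Y]. Applying the eigenvalue equation twice at [v] bounds [r ^ 2] by the
    number of edges between [A] and [X]. With [n] vertices in all this number is
    at most [k (n - k)]: for [k = n./2] trivially, and when there is no cycle of
    length [2k + 2] because a path on [2k + 1] vertices between [A] and [X \ v]
    with both ends in [A] would be closed into such a cycle by [v]; deleting
    vertices of small degree and then extending a path greedily shows that
    avoiding such paths forces few edges. In the case of equality all slack terms
    vanish, which makes [G] complete bipartite with parts [X] and [Y]. *)

Require Import Defs.
From mathcomp Require Import all_boot all_order all_algebra.
From mathcomp Require Import reals.
From mathcomp Require Import zify ring lra.
Import Order.TTheory GRing.Theory Num.Theory.
Local Open Scope ring_scope.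
Set Implicit Arguments.
Unset Strict Implicit.
Unset Printing Implicit Defensive.

(** * Counting edges between two vertex sets by means of long paths *)

Section EdgeCounting.
Local Open Scope nat_scope.
Variables (T : finType) (e : rel T).
Implicit Types A B : {set T}.

Definition edges_between A B := \sum_(a in A) \sum_(b in B) e a b.

Lemma edges_between_le A B : edges_between A B <= #|A| * #|B|.
Proof.
rewrite -sum_nat_const; apply: leq_sum => a _.
by rewrite -sum1_card; apply: leq_sum => b _; apply: leq_b1.
Qed.

Lemma edges_between_setD1l A B a : a \in A ->
  edges_between A B = \sum_(b in B) e a b + edges_between (A :\ a) B.
Proof. by move=> aA; rewrite /edges_between (big_setD1 a). Qed.

Lemma edges_between_setD1r A B b : b \in B ->
  edges_between A B = \sum_(a in A) e a b + edges_between A (B :\ b).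
Proof.
move=> bB; rewrite /edges_between -big_split /=.
by apply: eq_bigr => a _; rewrite (big_setD1 b).
Qed.

(** Pigeonhole; it extends a path by a vertex not yet visited. *)
Lemma fresh_neighbor A (f : pred T) (s : seq T) :
  count [in A] s < \sum_(a in A) f a -> exists2 a, a \in A & f a && (a \notin s).
Proof.
move=> lt_s; apply/exists_inP; rewrite -[X in is_true X]negbK negb_exists_in.
apply/negP => /forall_inP no_a; move: lt_s; rewrite ltnNge => /negP; apply.
rewrite -size_filter -big_mkcondr sum1_card -[X in _ <= X]/(size _).
apply: leq_trans (card_size _); apply/subset_leq_card/fintype.subsetP => a.
rewrite unfold_in mem_filter => /andP[aA fa].
by move: (no_a a aA); rewrite negb_and negbK fa /= => ->; rewrite andbT.
Qed.

Hypothesis e_sym : symmetric e.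

(** [k] is half the number of edges, so the path has [2k + 1] vertices. *)
Definition long_path A B k := exists x s,
  [/\ path e x s, uniq (x :: s), size s = k.*2,
      (x \in A) && (last x s \in A) & {subset x :: s <= A :|: B}].

(** Greedy extension at the head, two vertices at a time. After [i < k] rounds the path has [i + 1]
    vertices in [A] and [i] in [B], so its head in [A] has an unvisited neighbour in [B], and that
    one has an unvisited neighbour in [A]. *)
Lemma long_path_min_degree A B k : [disjoint A & B] -> A != set0 ->
    (forall a, a \in A -> k <= \sum_(b in B) e a b) ->
    (forall b, b \in B -> k < \sum_(a in A) e b a) ->
  long_path A B k.
Proof.
move=> dAB /set0Pn[x0 x0A] degA degB.
have notB a : a \in A -> (a \in B) = false by move=> aA; apply: disjointFr dAB aA.
have notA b : b \in B -> (b \in A) = false by move=> bB; apply: disjointFl dAB bB.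
suff /(_ k (leqnn k)) [x [s [? _]]] : forall i, i <= k -> exists x s,
  [/\ path e x s, uniq (x :: s), size s = i.*2,
      (x \in A) && (last x s \in A) & {subset x :: s <= A :|: B}]
  /\ count [in A] (x :: s) = i.+1 /\ count [in B] (x :: s) = i.
  by exists x, s.
elim=> [_|i IH lt_ik].
  exists x0, [::]; split; last by rewrite /= x0A notB.
  split; rewrite //= ?x0A //.
  by move=> y; rewrite !inE => /eqP->; rewrite x0A.
have [x [s [[px us ss /andP[xA lA] sub] [cA cB]]]] := IH (ltnW lt_ik).
have [|b bB /andP[exb bs]] := @fresh_neighbor B (e x) (x :: s).
  by rewrite cB; apply: leq_trans lt_ik (degA _ xA).
have [|a aA /andP[eba as']] := @fresh_neighbor A (e b) (b :: x :: s).
  rewrite [count _ _]/= -/(count [in A] (x :: s)) notA // cA.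
  exact: leq_ltn_trans lt_ik (degB _ bB).
exists a, [:: b, x & s]; split; last first.
  by move: cA cB; rewrite /= aA bB (notA b bB) (notB a aA) => -> ->.
split.
- by rewrite /= e_sym eba e_sym exb.
- by rewrite cons_uniq as' cons_uniq bs.
- by rewrite /= ss.
- by rewrite aA.
- move=> z; rewrite !in_cons => /or3P[/eqP->|/eqP->|zs].
  + by rewrite inE aA.
  + by rewrite inE bB orbT.
  + by apply: sub; rewrite in_cons.
Qed.

(** Induction on [#|A| + #|B|]: deleting a vertex of [A] of degree at most [k], or one of [B] of
    degree at most [k + 1], lowers the right side at least as much as the left. If no such vertex
    exists, the greedy path does. The term [k.+1 * k] stands on the left to avoid truncated
    subtraction. *)
Lemma edges_between_long_path A B k : [disjoint A & B] ->
    k.+1 <= #|A| -> k <= #|B| -> ~ long_path A B k.+1 ->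
  edges_between A B + k.+1 * k <= k * #|A| + k.+1 * #|B|.
Proof.
have [m] := ubnP (#|A| + #|B|); elim: m A B => // m IH A B ltm dAB kA kB noP.
have Hle := edges_between_le A B.
(* At either minimal size the claim reduces to the trivial bound [#|A| * #|B|]. *)
have [eA|neA] := eqVneq #|A| k.+1; first by rewrite eA in Hle *; nia.
have [eB|neB] := eqVneq #|B| k; first by rewrite eB in Hle *; nia.
have [/exists_inP[a aA da]|nA] := boolP [exists a in A, \sum_(b in B) e a b <= k].
  have cA := cardsD1 a A; rewrite aA in cA.
  rewrite (edges_between_setD1l _ aA).
  suff : edges_between (A :\ a) B + k.+1 * k <= k * #|A :\ a| + k.+1 * #|B| by nia.
  apply: IH => //; try lia.
  - by apply: disjointWl dAB; apply: subsetDl.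
  - case=> x [s [? ? ?]]; rewrite !in_setD1 => /andP[/andP[_ xA] /andP[_ lA]] sub.
    apply: noP; exists x, s; split=> //; first by rewrite xA.
    by move=> y /sub; rewrite !inE => /orP[/andP[_ ->] //|->]; rewrite orbT.
have [/exists_inP[b bB db]|nB] := boolP [exists b in B, \sum_(a in A) e a b <= k.+1].
  have cB := cardsD1 b B; rewrite bB in cB.
  rewrite (edges_between_setD1r _ bB).
  suff : edges_between A (B :\ b) + k.+1 * k <= k * #|A| + k.+1 * #|B :\ b| by nia.
  apply: IH => //; try lia.
  - by apply: disjointWr dAB; apply: subsetDl.
  - case=> x [s [? ? ? ? sub]]; apply: noP; exists x, s; split=> //.
    by move=> y /sub; rewrite !inE => /orP[->//|/andP[_ ->]]; rewrite orbT.
case: noP; apply: long_path_min_degree => //.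
- by rewrite -card_gt0; lia.
- move=> a aA; move: nA; rewrite negb_exists_in => /forall_inP/(_ a aA).
  by rewrite -ltnNge.
- move=> b bB; move: nB; rewrite negb_exists_in => /forall_inP/(_ b bB).
  by rewrite -ltnNge; under eq_bigr do rewrite e_sym.
Qed.

End EdgeCounting.

(** * Closing paths into cycles, and the bound [k (n - k)] in both cases *)

Section Cycles.
Local Open Scope nat_scope.
Variable G : sgraph.

Lemma contains_cycle (c : seq G) : 0 < size c -> cycle (@edge G) c -> uniq c ->
  contains_copy (cycle_graph (size c)) G.
Proof.
case: c => // x s _ /= /(pathP x) px us.
have step (i j : 'I_(size s).+1) : nat_of_ord j = i.+1 %% (size s).+1 ->
    edge (nth x (x :: s) i) (nth x (x :: s) j).
  move=> ->; have := px i; rewrite size_rcons ltn_ord => /(_ isT).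
  rewrite -rcons_cons nth_rcons /= ltn_ord nth_rcons.
  (* At the last index the successor wraps round to [x]. *)
  have := ltn_ord i; rewrite ltnS leq_eqVlt => /orP[/eqP->|lt_i].
    by rewrite modnn ltnn eqxx.
  by rewrite lt_i modn_small.
exists (fun i : 'I_(size s).+1 => nth x (x :: s) i) => [i j /eqP|i j].
  by rewrite (nth_uniq x) //= => /eqP/val_inj.
case/andP=> _ /orP[] /eqP; first exact: step.
by move/step; rewrite edge_sym.
Qed.

Lemma long_path_cycle k (v : G) (A B : {set G}) :
    (forall a, a \in A -> edge v a) -> v \notin A :|: B ->
    long_path (@edge G) A B k.+1 ->
  contains_copy (cycle_graph (2 * k.+1 + 2)) G.
Proof.
move=> vA vAB [x [s [px us ss /andP[xA lA] sub]]].
have -> : 2 * k.+1 + 2 = size [:: v, x & s] by rewrite /= ss; lia.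
apply: contains_cycle => //.
  by rewrite /= rcons_path px vA //= edge_sym vA.
by rewrite cons_uniq us andbT; apply: contra vAB => /sub.
Qed.

(** With [n = k + d], [k = a + p] and [a <= k <= d]: [a c <= a (p + d) <= p d + a d = k d]. *)
Lemma mul_le_balanced a c k n : 0 < k -> 2 * k <= n -> a + c <= n ->
  (a <= k) || (c <= k) ->
  a * c <= k * (n - k) /\ (a * c = k * (n - k) -> a + c = n).
Proof.
move=> k0 kn; have [d nE] : exists d, n = k + d by exists (n - k); lia.
have kd : k <= d by lia.
rewrite {}nE {n kn} addKn => acn ack.
wlog ak : a c acn ack / a <= k.
  move=> H; case/orP: (ack) => [/H//|ck]; first exact.
  by rewrite mulnC addnC; apply: H; rewrite // 1?addnC // orbC.
have [p kE] : exists p, k = a + p by exists (k - a); lia.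
have le_pd : p * a <= p * d by rewrite leq_mul2l; lia.
have le_ac : a * c <= a * (p + d) by rewrite leq_mul2l; lia.
have kdE : k * d = a * d + p * d by rewrite kE mulnDl.
rewrite mulnDr in le_ac; rewrite kdE; split; first by rewrite (mulnC a p) in le_ac; lia.
(* Equality is impossible for [a = 0], as [k d > 0]; for [a > 0] a smaller [c] makes the bound
   strict. *)
have [a0|a_gt0] := posnP a; first by rewrite a0 add0n in kE *; nia.
have : (a * c < a * (p + d)) = (c < p + d) by rewrite ltn_pmul2l.
by rewrite mulnDr (mulnC a p); case: (ltnP c); lia.
Qed.

Lemma edges_between_balanced (v : G) (A X : {set G}) k :
    0 < k -> k = #|G|./2 -> v \in X -> [disjoint X & A] ->
  edges_between (@edge G) A X <= k * (#|G| - k) /\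
  (edges_between (@edge G) A X = k * (#|G| - k) -> #|A| + #|X| = #|G|).
Proof.
move=> k0 kE vX dXA.
have le1 := edges_between_le (@edge G) A X.
have le2 : #|A| + #|X| <= #|G|.
  rewrite addnC -cardsUI (disjoint_setI0 dXA) cards0 addn0; exact: max_card.
by have [| |le3 eq3] := mul_le_balanced k0 _ le2; lia.
Qed.

(** If [A] or [X] has at most [k] elements, the product bound suffices. Otherwise [v] accounts for
    [#|A|] edges, and the path bound with [k - 1] for [A] and [X :\ v] adds up to at most [k (#|A| +
    #|X| - 1) - k (k - 1) <= k (n - k)]. *)
Lemma edges_between_even_cycle_free (v : G) (A X : {set G}) k :
    0 < k -> 2 * k <= #|G| -> free_of (cycle_graph (2 * k + 2)) G ->
    v \in X -> [disjoint X & A] -> (forall a, a \in A -> edge v a) ->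
  edges_between (@edge G) A X <= k * (#|G| - k) /\
  (edges_between (@edge G) A X = k * (#|G| - k) -> #|A| + #|X| = #|G|).
Proof.
case: k => // k k0 kn free vX dXA vA.
have le1 := edges_between_le (@edge G) A X.
have le2 : #|A| + #|X| <= #|G|.
  rewrite addnC -cardsUI (disjoint_setI0 dXA) cards0 addn0; exact: max_card.
have [small|big] := boolP ((#|A| <= k) || (#|X| <= k)).
  by have [|le3 eq3] := mul_le_balanced k0 kn le2; lia.
have cX := cardsD1 v X; rewrite vX in cX.
have : edges_between (@edge G) A (X :\ v) + k.+1 * k <= k * #|A| + k.+1 * #|X :\ v|.
  apply: edges_between_long_path; try lia.
  - exact: edge_sym.
  - by rewrite disjoint_sym; apply: disjointWl dXA; apply: subsetDl.
  - move/(@long_path_cycle k v) => H; apply: free; apply: H => //.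
    by rewrite !inE eqxx (disjointFr dXA).
have -> : edges_between (@edge G) A X = #|A| + edges_between (@edge G) A (X :\ v).
  rewrite (edges_between_setD1r _ _ vX); congr (_ + _).
  by rewrite -sum1_card; apply: eq_bigr => a /vA; rewrite edge_sym => ->.
have [d dE] : exists d, #|G| = k.+1 + d by exists (#|G| - k.+1); lia.
rewrite dE in le2 *; rewrite addKn => le3.
have : k.+1 * (#|A| + #|X :\ v|) <= k.+1 * (k + d) by rewrite leq_mul2l; lia.
have : (k.+1 * (#|A| + #|X :\ v|) < k.+1 * (k + d)) =
  (#|A| + #|X :\ v| < k + d) by rewrite ltn_pmul2l.
by split; nia.
Qed.

End Cycles.

(** * From edge bounds to the least eigenvalue *)

Section LeastEigenvalue.
Variables (R : realType) (G : sgraph).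
Implicit Types x : G -> R.

(** Eigenvectors indexed by vertices instead of ordinals; being nonzero is required separately. *)
Definition eigenfunction x a := forall u, \sum_(h | edge u h) x h = a * x u.

Lemma eigenfunctionP a :
  eigenvalue (adjacency_mx R G) a <->
  exists x, [/\ eigenfunction x a & exists v, x v != 0].
Proof.
have sumE (f : G -> R) u : \sum_(h | edge u h) f h =
    \sum_(i < #|G|) f (enum_val i) * (edge (enum_val i) u)%:R.
  rewrite big_mkcond big_enum_val /=; apply: eq_bigr => i _.
  by rewrite edge_sym; case: edge; rewrite ?mulr1 ?mulr0.
split=> [/eigenvalueP[w wA w0]|[x [xa [v xv]]]].
  exists (fun u => w 0 (enum_rank u)); split=> [u|].
    rewrite sumE; have /rowP/(_ (enum_rank u)) := wA; rewrite !mxE => <-.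
    by apply: eq_bigr => i _; rewrite mxE enum_rankK enum_valK.
  have [i wi] : exists i, w 0 i != 0.
    apply/existsP; apply: contraR w0; rewrite negb_exists => /forallP w0.
    by apply/eqP/rowP => i; rewrite mxE; apply/eqP; rewrite -[_ == _]negbK.
  by exists (enum_val i); rewrite enum_valK.
apply/eigenvalueP; exists (\row_i x (enum_val i)).
  apply/rowP => j; rewrite !mxE -xa sumE.
  by apply: eq_bigr => i _; rewrite !mxE.
apply: contra xv => /eqP/rowP/(_ (enum_rank v)).
by rewrite !mxE enum_rankK => ->.
Qed.

(* If [x v] is the largest entry of [x] and [r >= 0], the three subtracted sums
   are nonnegative. *)
Lemma least_eigenvalue_defect x r v (X := [set h | 0 < x h])
    (Y := [set h | x h < 0]) (A := [set u in Y | edge v u]) :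
  eigenfunction x (- r) ->
  r ^+ 2 * x v = (edges_between (@edge G) A X)%:R * x v -
    (\sum_(u in A) \sum_(w in X | edge u w) (x v - x w) +
     \sum_(u in A) \sum_(h in Y | edge u h) - x h +
     r * \sum_(h in X | edge v h) x h).
Proof.
move=> xr.
have split_sum u : \sum_(h | edge u h) x h =
    \sum_(h in X | edge u h) x h + \sum_(h in Y | edge u h) x h.
  rewrite !big_mkcond [X in _ = X + _]big_mkcond [X in _ = _ + X]big_mkcond.
  rewrite -big_split; apply: eq_bigr => h _ /=; rewrite !inE.
  by case: edge; case: (ltgtP (x h) 0) => [_|_|->]; rewrite ?addr0 ?add0r.
have wE : (edges_between (@edge G) A X)%:R * x v =
    \sum_(u in A) \sum_(w in X | edge u w) x v.
  rewrite natr_sum mulr_suml; apply: eq_bigr => u _.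
  rewrite natr_sum mulr_suml [RHS]big_mkcondr; apply: eq_bigr => w _.
  by case: edge; rewrite ?mul1r ?mul0r.
have uE u : \sum_(w in X | edge u w) (x v - x w) + \sum_(h in Y | edge u h) - x h
    = \sum_(w in X | edge u w) x v + r * x u.
  by rewrite sumrB sumrN -addrA -opprD -split_sum xr; ring.
rewrite wE -big_split /= (eq_bigr _ (fun u _ => uE u)).
rewrite big_split /= -mulr_sumr.
(* The second use of the eigenvalue equation, now at [v]: this sum is [- r * x v] minus the part
   over [X]. *)
have -> : \sum_(u in A) x u = \sum_(h in Y | edge v h) x h.
  by apply: eq_bigl => u; rewrite !inE.
have /eqP := split_sum v; rewrite xr => /eqP E.
by rewrite expr2 -mulrA -[r * x v]opprK -mulNr E; ring.
Qed.

(** The combinatorial input shared by both cases; its equality clause later forces [A] to be the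
    complement of [X]. *)
Definition edges_between_bound M := forall (v : G) (A X : {set G}),
  v \in X -> [disjoint X & A] -> (forall a, a \in A -> edge v a) ->
  (edges_between (@edge G) A X <= M)%N /\
  (edges_between (@edge G) A X = M -> #|A| + #|X| = #|G|)%N.

Lemma least_eigenvalue_bound_pos x r v M : edges_between_bound M ->
    0 < r -> eigenfunction x (- r) -> 0 < x v -> (forall h, x h <= x v) ->
  r ^+ 2 <= M%:R /\
  (r ^+ 2 = M%:R -> exists X : {set G},
     (forall u w, edge u w = (u \in X) (+) (w \in X)) /\
     (#|X| * #|~: X| = M)%N).
Proof.
move=> bM r0 xr xv0 xmax.
pose X := [set h | 0 < x h]; pose Y := [set h | x h < 0].
pose A w := [set u in Y | edge w u].
(* The defect terms depend on [w] because the equality case applies them at every vertex where [x]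
   is maximal. *)
pose D1 w := \sum_(u in A w) \sum_(h in X | edge u h) (x w - x h).
pose D2 w := \sum_(u in A w) \sum_(h in Y | edge u h) - x h.
pose D3 w := \sum_(h in X | edge w h) x h.
have XY : [disjoint X & Y].
  rewrite disjoint_subset; apply/fintype.subsetP => h.
  by rewrite !inE -leNgt => /ltW.
have bA w : x w = x v -> (edges_between (@edge G) (A w) X <= M)%N /\
    (edges_between (@edge G) (A w) X = M -> #|A w| + #|X| = #|G|)%N.
  move=> xw; apply: (bM w); first by rewrite inE xw.
    by apply: disjointWr XY; apply/fintype.subsetP => u; rewrite inE => /andP[].
  by move=> u; rewrite inE => /andP[].
have d1 w h : x w = x v -> 0 <= x w - x h by move=> ->; rewrite subr_ge0.
have d2 h : h \in Y -> 0 <= - x h by rewrite inE oppr_ge0 => /ltW.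
have d3 h : h \in X -> 0 <= x h by rewrite inE => /ltW.
have D1_ge0 w : x w = x v -> 0 <= D1 w.
  by move=> xw; do 2!apply: sumr_ge0 => ? _; apply: d1.
have D2_ge0 w : 0 <= D2 w by apply: sumr_ge0 => u _; apply: sumr_ge0 => h /andP[/d2].
have D3_ge0 w : 0 <= D3 w by apply: sumr_ge0 => ? /andP[/d3].
have defect w : r ^+ 2 * x w =
    (edges_between (@edge G) (A w) X)%:R * x w - (D1 w + D2 w + r * D3 w).
  exact: least_eigenvalue_defect.
have rD3_ge0 w : 0 <= r * D3 w by rewrite mulr_ge0 // ltW.
split.
  have [le_M _] := bA v erefl.
  rewrite -(ler_pM2r xv0) defect lerBlDr ler_wpDr ?addr_ge0 ?D1_ge0 //.
  by rewrite ler_pM2r // ler_nat.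
move=> rM.
have tight w : x w = x v -> [/\ edges_between (@edge G) (A w) X = M,
    A w = ~: X, D1 w = 0, D2 w = 0 & D3 w = 0].
  move=> xw; have [le_M eq_M] := bA w xw.
  have := defect w; rewrite rM xw => E.
  have le_R : (edges_between (@edge G) (A w) X)%:R * x v <= M%:R * x v.
    by rewrite ler_pM2r // ler_nat.
  have := D1_ge0 w xw; have := D2_ge0 w; have := rD3_ge0 w => g3 g2 g1.
  have eM : edges_between (@edge G) (A w) X = M.
    apply/eqP; rewrite -(eqr_nat R); apply/eqP/(mulIf (lt0r_neq0 xv0)); lra.
  rewrite eM in E.
  have [D1w D2w /eqP rD3w] : [/\ D1 w = 0, D2 w = 0 & r * D3 w = 0] by split; lra.
  rewrite mulf_eq0 (gt_eqF r0) in rD3w; split=> //; last exact/eqP.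
  (* [A w] lies in the complement of [X], and the equality clause gives both the same size. *)
  apply/eqP; rewrite eqEcard; apply/andP; split.
    by apply/fintype.subsetP => u; rewrite !inE -leNgt => /andP[/ltW].
  by have := eq_M eM; have := cardsC X; lia.
have [eM AvE D1v D2v _] := tight v erefl.
have notX h : h \notin X -> h \in Y.
  by rewrite -in_setC -AvE inE => /andP[].
(* A neighbour of [w] outside [X] lies in [A v], and [D1 v = 0] gives the claim. Without one, the
   sum of [x] over the neighbours of [w] is nonnegative, yet equals [- r * x w < 0]. *)
have xX w : w \in X -> x w = x v.
  move=> wX; have [/existsP[u /andP[uX euw]]|no_nbr] :=
    boolP [exists u, (u \notin X) && edge u w].
    have inner_ge0 u' : u' \in A v -> 0 <= \sum_(h in X | edge u' h) (x v - x h).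
      by move=> _; apply: sumr_ge0 => h _; apply: d1.
    have uA : u \in A v by rewrite AvE inE.
    have D1u := psumr_eq0P inner_ge0 D1v uA.
    have : x v - x w = 0.
      by apply: (psumr_eq0P _ D1u) => [h _|]; [apply: d1 | rewrite wX].
    by move/eqP; rewrite subr_eq0 => /eqP.
  have : 0 <= - r * x w.
    rewrite -xr; apply: sumr_ge0 => h ewh; apply: d3.
    move: no_nbr; rewrite negb_exists => /forallP/(_ h).
    by rewrite edge_sym ewh andbT negbK.
  by move: wX; rewrite inE => xw0; rewrite mulNr oppr_ge0 leNgt mulr_gt0.
exists X; split; last first.
  rewrite -eM AvE mulnC -sum_nat_const; apply: eq_bigr => u.
  rewrite -AvE inE => /andP[uY _].
  rewrite -sum1_card; apply: eq_bigr => w wX.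
  have [_ AwE _ _ _] := tight w (xX w wX).
  have : u \in A w by rewrite AwE inE (disjointFl XY uY).
  by rewrite inE edge_sym => /andP[_ ->].
have eXY u w : u \in X -> w \notin X -> edge u w.
  move=> uX wX; have [_ AuE _ _ _] := tight u (xX u uX).
  have : w \in A u by rewrite AuE inE.
  by rewrite inE => /andP[].
(* Edges inside [X] contradict [D3 u = 0], edges inside its complement [D2 v = 0]. *)
move=> u w; case: (boolP (u \in X)) => uX; case: (boolP (w \in X)) => wX /=.
- apply/negbTE/negP => euw.
  have [_ _ _ _ D3u] := tight u (xX u uX).
  have xw : x w = 0.
    by apply: (psumr_eq0P _ D3u) => [h /andP[/d3]|] //; rewrite wX.
  by rewrite inE xw ltxx in wX.
- exact: eXY.
- by rewrite edge_sym eXY.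
- apply/negbTE/negP => euw.
  have inner_ge0 u' : u' \in A v -> 0 <= \sum_(h in Y | edge u' h) - x h.
    by move=> _; apply: sumr_ge0 => h /andP[/d2].
  have uA : u \in A v by rewrite AvE inE.
  have D2u := psumr_eq0P inner_ge0 D2v uA.
  have wY := notX w wX.
  have /eqP : - x w = 0.
    by apply: (psumr_eq0P _ D2u) => [h /andP[/d2]|] //; rewrite wY.
  by rewrite oppr_eq0 => /eqP xw; rewrite inE xw ltxx in wY.
Qed.

(** Take [v] maximising the absolute value of [x], and replace [x] by its negative if [x v < 0]. *)
Lemma least_eigenvalue_bound r M : edges_between_bound M ->
    0 < r -> eigenvalue (adjacency_mx R G) (- r) ->
  r ^+ 2 <= M%:R /\
  (r ^+ 2 = M%:R -> exists X : {set G},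
     (forall u w, edge u w = (u \in X) (+) (w \in X)) /\
     (#|X| * #|~: X| = M)%N).
Proof.
move=> bM r0 /eigenfunctionP[x [xr [v0 xv0]]].
have [v _ vmax] := arg_maxP (fun h => `|x h|) (erefl : xpredT v0).
have v_neq0 : x v != 0.
  by rewrite -normr_gt0; apply: lt_le_trans (vmax v0 isT); rewrite normr_gt0.
have [xv|xv] := ltP 0 (x v).
  apply: (least_eigenvalue_bound_pos (v := v) bM r0 xr) => // h.
  by rewrite -(gtr0_norm xv); apply: le_trans (ler_norm _) (vmax h isT).
apply: (least_eigenvalue_bound_pos (x := fun h => - x h) (v := v) bM r0).
- by move=> u; rewrite sumrN xr mulrN.
- by rewrite oppr_gt0 lt_neqAle v_neq0.
- move=> h; rewrite -(ler0_norm xv); apply: le_trans (vmax h isT).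
  by rewrite -normrN ler_norm.
Qed.

(** * Complete bipartite graphs and the equality case *)

Lemma isomorphic_complete_bipartite (X : {set G}) p q :
    (forall u w, edge u w = (u \in X) (+) (w \in X)) ->
    #|X| = p -> #|~: X| = q ->
  isomorphic G (complete_bipartite p q).
Proof.
move=> eX <- <-.
pose g (z : 'I_#|X| + 'I_#|~: X|) : G :=
  match z with inl i => enum_val i | inr j => enum_val j end.
have gX z : (g z \in X) = (if z is inl _ then true else false).
  by case: z => i; have := enum_valP i; rewrite // inE => /negbTE.
have g_inj : injective g.
  move=> z z' E; have := gX z; rewrite E gX.
  by case: z z' E => i [] j //= /enum_val_inj->.
have g_card : (#|G| <= #|{: 'I_#|X| + 'I_#|~: X|}|)%N.
  by rewrite card_sum !card_ord cardsC.
have [f gK fK] := inj_card_bij g_inj g_card.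
exists f; first by exists g.
move=> u w; rewrite -{2}(fK u) -{2}(fK w) eX !gX.
by case: (f u) (f w) => i [].
Qed.

Lemma complete_bipartite_eigenvalue p q : (0 < p)%N -> (0 < q)%N ->
    isomorphic G (complete_bipartite p q) ->
  eigenvalue (adjacency_mx R G) (- Num.sqrt (p * q)%:R).
Proof.
move=> p0 q0 [f f_bij fE]; apply/eigenfunctionP.
(* Summing over neighbours gives [- q sqrt p] on the first side and [p sqrt q] on the second, which
   is [- sqrt (p q)] times [y]. *)
pose y (z : 'I_p + 'I_q) : R :=
  if z is inl _ then Num.sqrt q%:R else - Num.sqrt p%:R.
exists (fun u => y (f u)); split; last first.
  have [g _ gK] := f_bij; exists (g (inl (Ordinal p0))).
  by rewrite gK /= sqrtr_eq0 -ltNge ltr0n.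
move=> u; under eq_bigl do rewrite -fE.
have [g fK gK] := f_bij.
rewrite -(reindex f (P := edge (f u)) (F := y)); last by apply: onW_bij.
rewrite natrM sqrtrM ?ler0n //.
have sqK (m : nat) : Num.sqrt (m%:R : R) * Num.sqrt m%:R = m%:R.
  by rewrite -expr2 sqr_sqrtr.
rewrite big_sumType /=; case: (f u) => i /=.
  rewrite big_pred0 // add0r sumr_const card_ord -[LHS]mulr_natr.
  by rewrite -[in LHS](sqK q); ring.
rewrite [X in _ + X]big_pred0 // addr0 sumr_const card_ord -[LHS]mulr_natr.
by rewrite -[in LHS](sqK p); ring.
Qed.

Lemma least_eigenvalue_extremal k : (0 < k)%N -> (2 * k <= #|G|)%N ->
    edges_between_bound (k * (#|G| - k)) ->
  - Num.sqrt (k * (#|G| - k))%:R <= lambda_min R G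
  /\ (lambda_min R G = - Num.sqrt (k * (#|G| - k))%:R
       <-> isomorphic G (complete_bipartite k (#|G| - k))).
Proof.
move=> k0 kn bM; have G0 : (0 < #|G|)%N by lia.
have M0 : (0 < k * (#|G| - k))%N by rewrite muln_gt0; lia.
have eig := lambda_min_eigenvalue R G0.
have lower : - Num.sqrt (k * (#|G| - k))%:R <= lambda_min R G.
  rewrite lerNl; have [le0|gt0] := leP (- lambda_min R G) 0.
    exact: le_trans (sqrtr_ge0 _).
  rewrite -[in X in is_true (X <= _)](gtr0_norm gt0) -sqrtr_sqr ler_sqrt ?ler0n //.
  by have [|] := least_eigenvalue_bound bM gt0; rewrite ?opprK.
split=> //; split=> [lamE|iso]; last first.
  apply/le_anti; rewrite lower andbT; apply: lambda_min_le => //.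
  by apply: complete_bipartite_eigenvalue => //; lia.
have sq0 : 0 < Num.sqrt ((k * (#|G| - k))%:R : R) by rewrite sqrtr_gt0 ltr0n.
have [|_ []] := least_eigenvalue_bound bM sq0; first by rewrite -lamE.
  by rewrite sqr_sqrtr ?ler0n.
move=> X [eX cX]; have cC := cardsC X.
(* The sizes of [X] and its complement have the same sum and product as [k] and [n - k]. *)
have : (#|X| = k) \/ (#|~: X| = k) by nia.
case=> cXk; first by apply: (isomorphic_complete_bipartite eX) => //; lia.
apply: (@isomorphic_complete_bipartite (~: X)) => //; last by rewrite setCK; lia.
by move=> u w; rewrite eX !inE; case: (u \in X) (w \in X) => [] [].
Qed.

End LeastEigenvalue.

(** * The two cases: [k = n./2] in (i), and [k] given by the cycle length in (ii) *)

Theorem theorem1p3 (R : realType) (t n : nat) (G : sgraph)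
    (t_ge3 : (3 <= t)%N) (n_gt0 : (0 < n)%N) (orderG : #|G| = n)
    (CtfreeG : free_of (cycle_graph t) G) :
  (odd t \/ (n < t)%N ->
     - Num.sqrt (n./2 * uphalf n)%:R <= lambda_min R G
     /\ (lambda_min R G = - Num.sqrt (n./2 * uphalf n)%:R
         <-> isomorphic G (complete_bipartite n./2 (uphalf n))))
  /\
  (forall k : nat, (1 <= k)%N -> t = (2 * k + 2)%N -> (t <= n)%N ->
     - Num.sqrt (k * (n - k))%:R <= lambda_min R G
     /\ (lambda_min R G = - Num.sqrt (k * (n - k))%:R
         <-> isomorphic G (complete_bipartite k (n - k)))).
Proof.
split=> [_|k k0 tE tn]; last first.
  rewrite -orderG; apply: least_eigenvalue_extremal => //; first by lia.
  move=> v A X; apply: edges_between_even_cycle_free => //; first by lia.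
  by rewrite -tE.
have -> : uphalf n = (n - n./2)%N by rewrite uphalf_half; lia.
have [n2|n2] := leqP 2 n.
  rewrite -orderG in n2 *; apply: least_eigenvalue_extremal; try by lia.
  by move=> v A X vX dXA _; apply: edges_between_balanced vX dXA; lia.
(* For [n = 1] the value [k = n./2] is zero; a single vertex has least eigenvalue [0] and is the
   complete bipartite graph with parts of sizes [0] and [1]. *)
have {n2 n_gt0} n1 : n = 1%N by lia.
have edge0 (u w : G) : edge u w = false.
  have /fintype_le1P/(_ u w)-> : (#|G| <= 1)%N by rewrite orderG n1.
  exact: edge_irr.
have lam0 : lambda_min R G = 0.
  have : eigenvalue (adjacency_mx R G) (lambda_min R G).
    by apply: lambda_min_eigenvalue; rewrite orderG n1.
  move/eigenfunctionP => [x [xl [v xv]]]; apply: (mulIf xv).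
  by rewrite mul0r -xl big_pred0.
rewrite n1 mul0n sqrtr0 oppr0 lam0; split=> //; split=> // _.
apply: (@isomorphic_complete_bipartite _ set0).
- by move=> u w; rewrite edge0 !inE.
- exact: cards0.
- by rewrite setC0 cardsT orderG n1.
Qed.
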